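(* Let $\mathcal{H}$ be a normed space. For each one of the following identities (with its parameters fixed), the norm on $\mathcal{H}$ is given by an inner product if and only if the identity holds for all $x_1,\dots,x_n\in\mathcal{H}$: (a) for fixed integers $n>k\ge 2$, $$\binom{n-2}{k-2}\|x_1+\cdots+x_n\|^2=\sum_{A\subseteq\overline{n},\,|A|=k}\|x_A\|^2-\binom{n-2}{k-1}\sum_{i=1}^{n}\|x_i\|^2;$$ (b) for a fixed integer $n\ge 3$, $$\sum_{I\subseteq\overline{n}}(-1)^{|I|}\|x_I\|^2=0;$$ (c) for a fixed integer $n\ge 2$ and fixed real numbers $a_1,\dots,a_n$ such that $a_i=a_j=-\tfrac12$ for some indices $i\ne j$, $$\sum_{k=1}^{n}\ \sum_{1\le i_1<\cdots<i_k\le n} a_{i_1}\cdots a_{i_k}\sum_{\epsilon_1,\dots,\epsilon_k\in\{1,-1\}}\|\epsilon_1x_{i_1}+\cdots+\epsilon_kx_{i_k}\|^2=0.$$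
   Context: $\overline{n}=\{1,2,\dots,n\}$. For $A\subseteq\overline{n}$, $x_A=\sum_{i\in A}x_i$ (so $x_\emptyset=0$), and $|A|$ is the cardinality of $A$. The norm is given by an inner product if there is an inner product $\langle\cdot,\cdot\rangle$ on $\mathcal{H}$ with $\|x\|^2=\langle x,x\rangle$ for all $x\in\mathcal{H}$. *)

(* Defs.v *)
From HB Require Import structures.
From mathcomp Require Export all_boot all_order all_algebra.
From mathcomp Require Export complex.
From mathcomp Require Export reals normedtype.

Set Implicit Arguments.
Unset Strict Implicit.
Unset Printing Implicit Defensive.

Import Order.TTheory GRing.Theory Num.Theory.
Export numFieldNormedType.Exports.

Local Open Scope ring_scope.

(* The norm of a [normedModType K] is [K]-valued; over [K = R[i]] its values
   are the nonnegative reals inside [R[i]].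
   [{dot V for theta}] is the type of positive definite forms that are linear
   in the first argument and satisfy [ip x y = theta (ip y x)]: take
   [theta = idfun] for real spaces and [theta = Num.conj] for complex ones. *)
Definition norm_given_by_inner_product (K : numFieldType) (theta : K -> K)
    (V : normedModType K) : Prop :=
  exists ip : {dot V for theta}, forall x : V, `|x| ^+ 2 = ip x x.

Definition identity_a (K : numFieldType) (V : normedModType K) (n k : nat)
    (x : 'I_n -> V) : Prop :=
  'C(n - 2, k - 2)%:R * `|\sum_i x i| ^+ 2 =
  \sum_(A : {set 'I_n} | #|A| == k) `|\sum_(i in A) x i| ^+ 2
    - 'C(n - 2, k - 1)%:R * \sum_i `|x i| ^+ 2.

Definition identity_b (K : numFieldType) (V : normedModType K) (n : nat)
    (x : 'I_n -> V) : Prop :=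
  \sum_(I : {set 'I_n}) (-1) ^+ #|I| * `|\sum_(i in I) x i| ^+ 2 = 0.

Definition increasing_indices (n k : nat) (i : {ffun 'I_k -> 'I_n}) : bool :=
  [forall p : 'I_k, forall q : 'I_k, (p < q)%N ==> (i p < i q)%N].

(* The sign epsilon_p is encoded as [(-1) ^+ e p], with [e p : bool]. *)
Definition identity_c (K : numFieldType) (V : normedModType K) (n : nat)
    (a : 'I_n -> K) (x : 'I_n -> V) : Prop :=
  \sum_(1 <= k < n.+1)
    \sum_(i : {ffun 'I_k -> 'I_n} | increasing_indices i)
      (\prod_(p < k) a (i p)) *
      \sum_(e : {ffun 'I_k -> bool})
        `|\sum_(p < k) (-1) ^+ e p *: x (i p)| ^+ 2 = 0.

(* Main.v *)
Require Import Defs.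
From HB Require Import structures.
From mathcomp Require Import all_boot all_order all_algebra.
From mathcomp Require Import complex reals normedtype.
From mathcomp Require Import ring lra zify.

Import Order.TTheory GRing.Theory Num.Theory.
Local Open Scope ring_scope.

(** Put [q v = |v|^2].  All three identities turn out to be equivalent to the
    parallelogram law for [q], and by Jordan and von Neumann that law says that
    the norm comes from an inner product.

    Each identity is an iterated translation operator applied to [q] at [0].
    With [shift_step c x] the operator [1 + c T_x], where [T_x g y = g (y + x)],
    the product of these operators over the vectors [x_i] expands to the sum of
    [c ^+ #|A| * q x_A] over all subsets [A].  For [c = -1] this is (b).  Over
    the ring of polynomials with [c = 'X] the coefficient of ['X^k] selects the
    subsets of size [k], and this is the sum in (a).  Likewise the sum in (c) is
    the product of the operators [sym_step a x = 1 + a (T_x + T_(-x))]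
    ([sum_signed_subsets_sym]).

    The direct implications use that the third differences of the square of an
    inner product norm vanish.  For such a function the product of the
    [1 + c T_x] has a closed form with a factor [(1 + c) ^ (n - 2)]
    ([foldr_shift_quad]), whose coefficients are the binomials of (a) and which
    is zero at [c = -1].  In (c), one factor with [a = -1/2] sends [q] to a
    constant, by the parallelogram law, and another one kills that constant.

    For the converses, (a) is tested on [u, v, -v, 0, ..., 0]: what remains is
    a nonzero binomial times the defect of the parallelogram law.  From (b) and
    (c) the weaker fact is extracted that, for some [m >= 2], every product of
    [m] second differences of [q] vanishes at [0]
    ([vanishing_half_diff2_of_shift], [foldr_sym_pad0]).  A descent on [m]
    then uses the homogeneity of [q].  If all products of [m + 1] second
    differences vanish, doubling one direction multiplies a product of [m] of
    them by [4], so doubling all directions multiplies it by [4 ^ m];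
    homogeneity says that it is multiplied by [4], hence it is zero
    ([vanishing_half_diff2_descent]).  At [m = 2] the vanishing is the
    parallelogram law. *)

Set Implicit Arguments.
Unset Strict Implicit.
Unset Printing Implicit Defensive.

(** * Products of translation operators as sums over subsets *)

Lemma sum_subsets_setU1 (T : finType) (L : nmodType) (i : T) (S : {set T})
    (F : {set T} -> L) : i \notin S ->
  \sum_(A : {set T} | A \subset i |: S) F A =
  \sum_(A : {set T} | A \subset S) (F A + F (i |: A)).
Proof.
move=> iS; rewrite big_split (bigID (fun A : {set T} => i \notin A)) /=.
congr (_ + _).
  apply: eq_bigl => A; apply/andP/idP => [[sA iA] | sA].
    apply/subsetP => j jA; have := subsetP sA j jA.
    by rewrite !inE => /predU1P[ji|//]; rewrite -ji jA in iA.
  by split; [exact: subset_trans sA (subsetUr _ _) | apply: contra iS; exact: subsetP].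
rewrite (reindex_onto (fun A : {set T} => i |: A) (fun A : {set T} => A :\ i)).
  apply: eq_bigl => A; rewrite setU11 andbT /=.
  apply/andP/idP => [[sA /eqP eA]|sA].
    by rewrite -eA subDset.
  split; first exact: setUS.
  rewrite setU1K //; apply: contra iS; exact: subsetP.
by move=> A /andP[_ /negPn iA]; rewrite setD1K.
Qed.

(** The operator [1 + c T_x] on functions, [T_x] being the translation by [x]. *)
Definition shift_step (V : nmodType) (L : pzRingType) (c : L) (x : V)
  (g : V -> L) (y : V) : L := g y + c * g (y + x).

(** The operator [1 + a (T_x + T_(-x))]. *)
Definition sym_step (V : zmodType) (L : pzRingType) (a : L) (x : V)
  (g : V -> L) (y : V) : L := g y + a * (g (y + x) + g (y - x)).

(** Expansion of the product of the operators [1 + c T_(x i)]: a subset [A]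
    records the factors in which [c T_(x i)] is chosen. *)
Lemma sum_subsets_shift (T : finType) (V : nmodType) (L : pzRingType) (c : L)
    (f : V -> L) (x : T -> V) (s : seq T) (y : V) : uniq s ->
  \sum_(A : {set T} | A \subset s) c ^+ #|A| * f (y + \sum_(i in A) x i) =
  foldr (shift_step c) f [seq x i | i <- s] y.
Proof.
elim: s y => [|i s IHs] y /=.
  move=> _; rewrite (big_pred1 set0) ?cards0 ?expr0 ?mul1r ?big_set0 ?addr0 //.
  move=> A /=; rewrite -subset0; apply: eq_subset_r => j; by rewrite !inE.
case/andP=> iS us; rewrite /shift_step -!IHs // mulr_sumr -big_split /=.
have eqs (A : {set T}) : (A \subset i :: s) = (A \subset i |: [set j in s]).
  by apply: eq_subset_r => j; rewrite !inE.
have eqs' (A : {set T}) : (A \subset s) = (A \subset [set j in s]).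
  by apply: eq_subset_r => j; rewrite !inE.
rewrite (eq_bigl _ _ eqs) sum_subsets_setU1 ?inE // [RHS](eq_bigl _ _ eqs').
apply: eq_bigr => A sA.
have iA : i \notin A by apply: contra iS => /(subsetP sA); rewrite inE.
by rewrite cardsU1 iA big_setU1 //= exprS mulrA addrA.
Qed.

Lemma sum_sets_shift (n : nat) (V : nmodType) (L : pzRingType) (c : L)
    (f : V -> L) (x : 'I_n -> V) :
  \sum_(A : {set 'I_n}) c ^+ #|A| * f (\sum_(i in A) x i) =
  foldr (shift_step c) f [seq x i | i <- enum 'I_n] 0.
Proof.
rewrite -sum_subsets_shift ?enum_uniq //; symmetry.
rewrite (eq_bigl xpredT) => [|A].
  by apply: eq_bigr => A _; rewrite add0r.
by apply/subsetP => j _; rewrite mem_enum.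
Qed.

(** Expansion of the product of the operators [1 + a i (T_(x i) + T_(- x i))]:
    [A] records the factors in which a translation is chosen, and [E] those
    among them that translate by [- x i]. *)
Lemma sum_signed_subsets_sym (T : finType) (K : comPzRingType) (V : lmodType K)
    (a : T -> K) (f : V -> K) (x : T -> V) (s : seq T) (y : V) : uniq s ->
  \sum_(A : {set T} | A \subset s) (\prod_(i in A) a i) *
     \sum_(E : {set T} | E \subset A)
        f (y + \sum_(i in A) (-1) ^+ (i \in E) *: x i) =
  foldr (fun i => sym_step (a i) (x i)) f s y.
Proof.
elim: s y => [|i s IHs] y /=.
  move=> _; rewrite (big_pred1 set0) => [|A /=]; last first.
    by rewrite -subset0; apply: eq_subset_r => j; rewrite !inE.
  rewrite big_set0 mul1r (big_pred1 set0) ?big_set0 ?addr0 //.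
  by move=> A /=; rewrite subset0.
case/andP=> iS us; rewrite /sym_step -!IHs // mulrDr !mulr_sumr -!big_split /=.
have eqs (A : {set T}) : (A \subset i :: s) = (A \subset i |: [set j in s]).
  by apply: eq_subset_r => j; rewrite !inE.
have eqs' (A : {set T}) : (A \subset s) = (A \subset [set j in s]).
  by apply: eq_subset_r => j; rewrite !inE.
rewrite (eq_bigl _ _ eqs) sum_subsets_setU1 ?inE // [RHS](eq_bigl _ _ eqs').
apply: eq_bigr => A sA.
have iA : i \notin A by apply: contra iS => /(subsetP sA); rewrite inE.
congr (_ + _); rewrite big_setU1 //= -!mulrA -!mulrDr; congr (_ * (_ * _)).
rewrite sum_subsets_setU1 // -big_split /=; apply: eq_bigr => E sE.
have iE : i \notin E by apply: contra iA; exact: subsetP.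
rewrite !big_setU1 //= (negPf iE) setU11 expr0 expr1 scale1r scaleN1r !addrA.
congr (_ + f (_ + _)); apply: eq_bigr => j jA.
rewrite !inE; case: eqVneq => // ji; by rewrite ji (negPf iA) in jA.
Qed.

(** A sign pattern is determined by the set of the [h p] that get a minus sign. *)
Lemma sum_signs_imset (I T : finType) (K : pzRingType) (V : lmodType K)
    (L : nmodType) (f : V -> L) (x : T -> V) (h : I -> T) : injective h ->
  \sum_(e : {ffun I -> bool}) f (\sum_p (-1) ^+ e p *: x (h p)) =
  \sum_(E : {set T} | E \subset [set h p | p : I])
    f (\sum_(i in [set h p | p : I]) (-1) ^+ (i \in E) *: x i).
Proof.
move=> h_inj.
rewrite [RHS](reindex_onto (fun e : {ffun I -> bool} => [set h p | p : I & e p])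
                     (fun E : {set T} => [ffun p => h p \in E])) /=.
  have mem_h (e : {ffun I -> bool}) p : (h p \in [set h q | q : I & e q]) = e p.
    by rewrite mem_imset // inE.
  apply: eq_big => [e|e _].
    symmetry; apply/andP; split; first by apply/imsetS/subsetP.
    by apply/eqP/ffunP => p; rewrite ffunE mem_h.
  rewrite big_imset /=; last by move=> p q _ _; exact: h_inj.
  by congr f; apply: eq_bigr => p _; rewrite mem_h.
move=> E sE; apply/setP => i; apply/imsetP/idP => [[p]|iE].
  by rewrite inE ffunE => pE ->.
have /imsetP[p _ ip] := subsetP sE i iE.
by exists p => //; rewrite inE ffunE -ip.
Qed.

Section IncreasingIndices.
Variables n k : nat.

Lemma increasing_indices_inj (u : {ffun 'I_k -> 'I_n}) :
  increasing_indices u -> injective u.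
Proof.
move=> /forallP uP p q upq; apply/val_inj/eqP.
have H r s : u r = u s -> ~~ (r < s)%N.
  move=> urs; apply/negP => rs; have /forallP/(_ s)/implyP/(_ rs) := uP r.
  by rewrite urs ltnn.
by rewrite eqn_leq leqNgt H //= leqNgt H.
Qed.

(** An increasing [k]-tuple of indices is the sorted list of a unique [k]-set. *)
Lemma sum_increasing_indices (L : nmodType) (F : {set 'I_n} -> L) : (0 < n)%N ->
  \sum_(u : {ffun 'I_k -> 'I_n} | increasing_indices u) F [set u p | p : 'I_k] =
  \sum_(A : {set 'I_n} | #|A| == k) F A.
Proof.
move=> n_gt0; pose i0 := Ordinal n_gt0; symmetry.
have sorted_enum (A : {set 'I_n}) : sorted ltn (map val (enum A)).
  rewrite -[enum _](eq_filter (mem_enum _)).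
  rewrite -(eq_filter (mem_map val_inj _)) -filter_map.
  by rewrite (sorted_filter ltn_trans) // unlock val_ord_enum iota_ltn_sorted.
rewrite (reindex_onto (fun u : {ffun 'I_k -> 'I_n} => [set u p | p : 'I_k])
                  (fun A : {set 'I_n} => [ffun p : 'I_k => nth i0 (enum A) p])) /=.
  apply: eq_bigl => u; apply/andP/idP => [[/eqP cu /eqP eu]|uP].
    apply/forallP => p; apply/forallP => q; apply/implyP => pq.
    rewrite -eu !ffunE; set A := [set _ | _ in _] in cu *.
    have szA : size (map val (enum A)) = k by rewrite size_map -cardE.
    have := sorted_ltn_nth ltn_trans 0%N (sorted_enum A).
    move=> /(_ p q); rewrite !inE szA !ltn_ord => /(_ isT isT pq).
    by rewrite !(nth_map i0) // -cardE cu.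
  have u_inj := increasing_indices_inj uP.
  rewrite card_imset // card_ord eqxx; split=> //.
  have enumE : enum [set u p | p : 'I_k] = [seq u p | p <- enum 'I_k].
    apply: (inj_map val_inj); apply: (irr_sorted_eq ltn_trans ltnn) => //.
      rewrite -map_comp; case: k u uP {u_inj} => [|k'] u /forallP uP.
        by rewrite (size0nil (size_enum_ord 0)).
      apply/(sortedP 0%N) => p; rewrite size_map size_enum_ord => lt_p.
      rewrite !(nth_map ord0 _ (val \o u)) ?size_enum_ord ?(ltnW lt_p) //.
      have /forallP/(_ (Ordinal lt_p))/implyP := uP (Ordinal (ltnW lt_p)).
      rewrite (nth_ord_enum _ (Ordinal (ltnW lt_p))).
      by rewrite (nth_ord_enum _ (Ordinal lt_p)); apply.
    move=> i; apply/mapP/mapP => -[j jP ->]; exists j => //.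
      move: jP; rewrite mem_enum => /imsetP[p _ ->].
      by apply: map_f; rewrite mem_enum.
    by case/mapP: jP => p _ ->; rewrite mem_enum imset_f.
  apply/eqP/ffunP => p; rewrite ffunE enumE (nth_map p) ?size_enum_ord //.
  by rewrite nth_ord_enum.
move=> A /eqP cA; apply/setP => i; apply/imsetP/idP => [[p _ ->]|iA].
  by rewrite ffunE -mem_enum mem_nth // -cardE cA.
have lt_i : (index i (enum A) < k)%N by rewrite -cA cardE index_mem mem_enum.
by exists (Ordinal lt_i) => //; rewrite ffunE nth_index // mem_enum.
Qed.

End IncreasingIndices.

Lemma identity_cE (K : numFieldType) (V : normedModType K) (n : nat)
    (a : 'I_n -> K) (x : 'I_n -> V) : (0 < n)%N ->
  identity_c a x <->
  foldr (fun i => sym_step (a i) (x i)) (fun v : V => `|v| ^+ 2) (enum 'I_n) 0 = 0.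
Proof.
move=> n_gt0; rewrite -sum_signed_subsets_sym ?enum_uniq // /identity_c.
pose F (A : {set 'I_n}) := (\prod_(i in A) a i) *
  \sum_(E : {set 'I_n} | E \subset A) `|\sum_(i in A) (-1) ^+ (i \in E) *: x i| ^+ 2.
have eqk k : \sum_(i : {ffun 'I_k -> 'I_n} | increasing_indices i)
      (\prod_(p < k) a (i p)) *
      \sum_(e : {ffun 'I_k -> bool}) `|\sum_(p < k) (-1) ^+ e p *: x (i p)| ^+ 2
   = \sum_(A : {set 'I_n} | #|A| == k) F A.
  rewrite -sum_increasing_indices //; apply: eq_bigr => u uP.
  have u_inj := increasing_indices_inj uP.
  rewrite /F -(sum_signs_imset (fun v => `|v| ^+ 2)) // big_imset //.
  by move=> p q _ _; exact: u_inj.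
under eq_bigr => k _ do rewrite eqk.
suff -> : \sum_(1 <= k < n.+1) \sum_(A : {set 'I_n} | #|A| == k) F A =
  \sum_(A : {set 'I_n} | A \subset enum 'I_n) (\prod_(i in A) a i) *
     \sum_(E : {set 'I_n} | E \subset A)
        `|0 + \sum_(i in A) (-1) ^+ (i \in E) *: x i| ^+ 2 by [].
transitivity (\sum_(A : {set 'I_n}) F A); last first.
  apply: eq_big => [A|A _].
    by symmetry; apply/subsetP => j _; rewrite mem_enum.
  by congr (_ * _); apply: eq_bigr => E _; rewrite add0r.
have F0 : \sum_(A : {set 'I_n} | #|A| == 0%N) F A = 0.
  rewrite (big_pred1 set0) => [|A]; last by rewrite cards_eq0.
  rewrite /F big_set0 mul1r (big_pred1 set0) => [|A]; last by rewrite subset0.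
  by rewrite big_set0 normr0 expr0n.
transitivity (\sum_(0 <= k < n.+1) \sum_(A : {set 'I_n} | #|A| == k) F A).
  by rewrite [RHS]big_ltn // F0 add0r.
rewrite big_mkord.
have card_le (A : {set 'I_n}) : (#|A| < n.+1)%N.
  by rewrite ltnS -[leqRHS]card_ord max_card.
rewrite (partition_big (fun A => Ordinal (card_le A)) xpredT) //=.
Qed.

(** * Functions whose third differences vanish *)

(** The polynomial functions of degree at most [2] that vanish at [0]. *)
Definition third_difference_free (V : zmodType) (L : nmodType) (f : V -> L) :=
  forall x y z,
    f (x + y + z) + f x + f y + f z = f (x + y) + f (y + z) + f (x + z).

Section Quadratic.
Variables (V : zmodType) (L : comPzRingType) (f : V -> L).
Hypothesis f_quad : third_difference_free f.

Lemma third_difference_free0 : f 0 = 0.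
Proof.
have := f_quad 0 0 0; rewrite !addr0 => /(congr1 (fun t => t - f 0 *+ 3)).
by rewrite !mulrS mulr0n addr0 !opprD !addrA !addrK subrr.
Qed.

(** At [y = 0] this is [(1 + c)^m (c^2 f (sum x) + c sum (f x))], which contains
    identities (a) and (b).  A general base point is needed for the induction,
    whose step is exactly the vanishing of the third difference at [y], the new
    vector and the sum of the others. *)
Lemma foldr_shift_quad (c : L) (s : seq V) (m : nat) (y : V) : size s = m.+2 ->
  foldr (shift_step c) f s y =
  (1 + c) ^+ m * ((1 + c) * f y + c * (1 + c) * f (y + \sum_(v <- s) v)
                  + c * (\sum_(v <- s) f v - f (\sum_(v <- s) v))).
Proof.
elim: s m y => // x s IHs [|m] y [].
  case: s {IHs} => [|z [|]] //= _; rewrite /shift_step !big_cons !big_nil !addr0.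
  have := f_quad y x z; rewrite !addrA => /(congr1 (fun t => t - f y - f x - f z)).
  have -> : f (y + x + z) + f y + f x + f z - f y - f x - f z = f (y + x + z) by ring.
  move=> ->; ring.
move=> sz; rewrite /= /shift_step !(IHs m) // !big_cons.
set S := \sum_(v <- s) v; set F := \sum_(v <- s) f v.
have := f_quad y x S; rewrite addrA => /(congr1 (fun t => t - f y - f x - f S)).
have -> : f (y + x + S) + f y + f x + f S - f y - f x - f S = f (y + x + S) by ring.
move=> ->; rewrite exprS; ring.
Qed.

End Quadratic.

(** * Vanishing second differences and the parallelogram law *)

Definition parallelogram (V : zmodType) (L : nmodType) (f : V -> L) :=
  forall x y, f (x + y) + f (x - y) = f x *+ 2 + f y *+ 2.

Section SecondDifferences.
Variables (V : zmodType) (K : numFieldType).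
Implicit Types (f g : V -> K) (s p : seq V) (v y : V).

(** Half of the second difference in direction [x], with a minus sign:
    [g y - (g (y + x) + g (y - x)) / 2]. *)
Definition half_diff2 : V -> (V -> K) -> V -> K := sym_step (- (1 / 2)).

(** With [E_v] for [half_diff2 v]: [T_(2v) + T_(-2v) = (T_v + T_(-v))^2 - 2]
    becomes [E_(2v) = 4 E_v - 2 E_v^2]. *)
Lemma half_diff2_double v g y :
  half_diff2 (v + v) g y = 4 * half_diff2 v g y - 2 * half_diff2 v (half_diff2 v g) y.
Proof.
rewrite /half_diff2 /sym_step addrK subrK opprD !addrA; by field.
Qed.

Lemma foldr_half_diff2_double p v s f y :
  foldr half_diff2 f (p ++ v + v :: s) y =
  4 * foldr half_diff2 f (p ++ v :: s) y - 2 * foldr half_diff2 f (p ++ v :: v :: s) y.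
Proof.
elim: p y => [|z p IHp] y /=; first exact: half_diff2_double.
rewrite {1 3 5}/half_diff2 /sym_step !IHp; ring.
Qed.

Lemma foldr_half_diff2_scale f s y :
  (forall v, f (v + v) = 4 * f v) ->
  foldr half_diff2 f [seq v + v | v <- s] (y + y) = 4 * foldr half_diff2 f s y.
Proof.
move=> f2; elim: s y => [|v s IHs] y //=.
rewrite /half_diff2 /sym_step -/half_diff2 [y + y + _]addrACA.
rewrite opprD [y + y + _]addrACA !IHs; ring.
Qed.

Definition vanishing_half_diff2 f m :=
  forall s, size s = m -> foldr half_diff2 f s 0 = 0.

(** Doubling the [m] directions one at a time multiplies a product of [m] second
    differences by [4 ^ m], since the quadratic terms of [half_diff2_double] are
    products of [m + 1] of them.  Homogeneity of [f] gives the factor [4]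
    instead, and [4 ^ m != 4]. *)
Lemma vanishing_half_diff2_descent f m :
  (forall v, f (v + v) = 4 * f v) -> (2 <= m)%N ->
  vanishing_half_diff2 f m.+1 -> vanishing_half_diff2 f m.
Proof.
move=> f2 m_ge2 f_van s sz.
(* A doubled direction whose factor [4] is out joins the undoubled prefix [p]. *)
have prefix p s' : (size p + size s')%N = m ->
    foldr half_diff2 f (p ++ [seq v + v | v <- s']) 0 =
    4 ^+ size s' * foldr half_diff2 f (p ++ s') 0.
  elim: s' p => [|v s' IHs] p szp; first by rewrite mul1r.
  rewrite /= foldr_half_diff2_double.
  rewrite (f_van (p ++ v :: v :: _)); last first.
    by rewrite size_cat /= size_map !addnS -szp /= addnS.
  rewrite -cat_rcons IHs ?size_rcons ?addSnnS // cat_rcons exprS; ring.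
have := prefix [::] s sz; rewrite /= -[X in foldr _ _ _ X](addr0 0).
rewrite foldr_half_diff2_scale // sz => /eqP.
rewrite -subr_eq0 -mulrBl mulf_eq0 => /orP[|/eqP //].
rewrite subr_eq0 -[X in X == _]expr1 -!natrX eqr_nat eqn_exp2l //; lia.
Qed.

Lemma vanishing_half_diff2_parallelogram f m :
  (forall v, f (v + v) = 4 * f v) -> (forall v, f (- v) = f v) -> f 0 = 0 ->
  (2 <= m)%N -> vanishing_half_diff2 f m -> parallelogram f.
Proof.
move=> f2 fN f0; elim: m => // m IHm; rewrite leq_eqVlt => /orP[/eqP <-|m_ge2]; last first.
  by move/(vanishing_half_diff2_descent f2 m_ge2); exact: IHm.
move=> f_van x y; have := f_van [:: x; y] erefl.
rewrite /= /half_diff2 /sym_step !add0r f0 [- x + y]addrC.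
rewrite -(fN (y - x)) -(fN (- x - y)) !opprD !opprK !fN [- y + x]addrC => e.
apply/eqP; rewrite -subr_eq0; apply/eqP; rewrite -[RHS](mulr0 2) -e !mulr2n; by field.
Qed.

Lemma third_difference_free_parallelogram f :
  (forall v, f (- v) = f v) -> third_difference_free f -> parallelogram f.
Proof.
move=> fN f_quad x y; have := f_quad x y (- y).
rewrite addrK subrr (third_difference_free0 f_quad) fN addr0 => <-.
by rewrite !mulr2n !addrA.
Qed.

(** The parallelogram law reads [(T_x + T_(-x)) f = 2 f + 2 f x], so the functions
    [k f + d] are stable under every [sym_step a x], which multiplies both [k]
    and the constants by [1 + 2 a]. *)
Lemma foldr_sym_affine f (c : seq (K * V)) :
  parallelogram f -> exists d, forall y,
    foldr (fun q => sym_step q.1 q.2) f c y = (\prod_(q <- c) (1 + 2 * q.1)) * f y + d.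
Proof.
move=> f_par; elim: c => [|[a x] c [d IHc]].
  by exists 0 => y; rewrite big_nil mul1r addr0.
exists ((\prod_(q <- c) (1 + 2 * q.1)) * (2 * a * f x) + (1 + 2 * a) * d) => y.
rewrite big_cons /= /sym_step !IHc /=.
have -> : f (y + x) = f y *+ 2 + f x *+ 2 - f (y - x) by rewrite -f_par addrK.
by ring.
Qed.

(** One factor with [1 + 2 a = 0] leaves a constant function, and the second such
    factor annihilates it. *)
Lemma foldr_sym_parallelogram f (c : seq (K * V)) y :
  parallelogram f -> (2 <= count (fun q => q.1 == - (1 / 2)%R) c)%N ->
  foldr (fun q => sym_step q.1 q.2) f c y = 0.
Proof.
move=> f_par; elim: c y => // -[a x] c IHc y /=; rewrite /sym_step /=.
case: eqP => [->|_] /=; last by rewrite add0n => cc; rewrite !IHc //; ring.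
rewrite ltnS -has_count => /hasP[q qc /eqP qE].
have [d dE] := foldr_sym_affine c f_par; rewrite !dE.
rewrite (big_rem q) //= qE; have -> : 1 + 2 * - (1 / 2) = 0 :> K by field.
by field.
Qed.

(** At [x = 0] the operator [sym_step a x] is multiplication by [1 + 2 a].  Zero
    vectors in the places where [a != -1/2] thus leave, up to a nonzero factor,
    the product of second differences along the remaining vectors. *)
Lemma foldr_sym_pad0 f (b : seq K) s :
  size s = count (pred1 (- (1 / 2))) b ->
  exists c, [/\ unzip1 c = b &
    exists2 k, k != 0 & forall y,
      foldr (fun q => sym_step q.1 q.2) f c y = k * foldr half_diff2 f s y].
Proof.
elim: b s => [|a b IHb] s /=.
  move/size0nil->; exists [::]; split=> //; exists 1; first exact: oner_neq0.
  by move=> y; rewrite mul1r.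
case: eqP => [->|/eqP a_half].
  case: s => // x s [/IHb[c [cb [k k0 kE]]]].
  exists ((- (1 / 2), x) :: c); split; first by rewrite /= cb.
  exists k => // y /=; rewrite [half_diff2 x _ y]/half_diff2 /sym_step !kE /=; ring.
rewrite add0n => /IHb[c [cb [k k0 kE]]].
exists ((a, 0) :: c); split; first by rewrite /= cb.
exists ((1 + 2 * a) * k) => [|y].
  rewrite mulf_neq0 //; apply: contra a_half => /eqP e; apply/eqP.
  have -> : a = (1 + 2 * a - 1) / 2 by field.
  by rewrite e; field.
by rewrite /= /sym_step subr0 addr0 kE; ring.
Qed.

End SecondDifferences.

Section NormSquare.
Variables (K : numFieldType) (V : normedModType K).

Definition sqnorm (v : V) : K := `|v| ^+ 2.

Lemma sqnorm0 : sqnorm 0 = 0.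
Proof. by rewrite /sqnorm normr0 expr0n. Qed.

Lemma sqnormN v : sqnorm (- v) = sqnorm v.
Proof. by rewrite /sqnorm normrN. Qed.

Lemma sqnorm_double v : sqnorm (v + v) = 4 * sqnorm v.
Proof. by rewrite /sqnorm -mulr2n normrMn exprMn_n mulr_natl. Qed.

Lemma identity_c_parallelogram n (a : 'I_n -> K) :
  (exists i j : 'I_n, [/\ i != j, a i = - (1 / 2) & a j = - (1 / 2)]) ->
  parallelogram sqnorm <-> (forall x : 'I_n -> V, identity_c a x).
Proof.
case=> i [j [ij ai aj]]; have n_gt0 : (0 < n)%N by exact: leq_ltn_trans (ltn_ord i).
set f := fun p : K * V => sym_step (V := V) (L := K) p.1 p.2.
pose b := [seq a l | l <- enum 'I_n].
have count_b : (2 <= count (pred1 (- (1 / 2))) b)%N.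
  rewrite count_map -size_filter; apply: (@uniq_leq_size _ [:: i; j]).
    by rewrite /= inE ij.
  by move=> l; rewrite !inE mem_filter mem_enum /= andbT => /orP[]/eqP->; apply/eqP.
have zipE (x : 'I_n -> V) :
    foldr (fun i => sym_step (a i) (x i)) sqnorm (enum 'I_n) =
    foldr f sqnorm [seq (a l, x l) | l <- enum 'I_n] by rewrite foldr_map.
split=> [par x|id_c].
  apply/(identity_cE _ _ n_gt0); rewrite -/sqnorm zipE foldr_sym_parallelogram //.
  by rewrite count_map; move: count_b; rewrite count_map.
apply: (vanishing_half_diff2_parallelogram sqnorm_double sqnormN sqnorm0 count_b).
move=> s /(foldr_sym_pad0 sqnorm)[c [cb [k k0 kE]]].
have szc : size c = n by rewrite -(size_map fst) [map _ _]cb size_map size_enum_ord.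
pose x (l : 'I_n) := (nth (0, 0) c l).2.
have := (identity_cE _ _ n_gt0).1 (id_c x); rewrite -/sqnorm zipE.
have -> : [seq (a l, x l) | l <- enum 'I_n] = c.
  apply: (@eq_from_nth _ (0, 0)); first by rewrite size_map size_enum_ord.
  move=> m; rewrite size_map size_enum_ord => lt_m.
  rewrite (nth_map (Ordinal lt_m)) ?size_enum_ord //.
  rewrite (nth_ord_enum _ (Ordinal lt_m)) /x /= [RHS]surjective_pairing.
  congr (_, _); rewrite -[RHS](nth_map _ 0) ?szc // [map _ _]cb.
  rewrite (nth_map (Ordinal lt_m)) ?size_enum_ord //.
  by rewrite (nth_ord_enum _ (Ordinal lt_m)).
by rewrite kE => /eqP; rewrite mulf_eq0 (negPf k0) => /eqP.
Qed.

End NormSquare.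

(** * The alternating identity and the identity over subsets of fixed size *)

Lemma coef_exp1X (K : nzRingType) (m j : nat) : ((1 + 'X) ^+ m : {poly K})`_j = 'C(m, j)%:R.
Proof.
rewrite addrC exprD1n.
have -> : \sum_(i < m.+1) 'X^i *+ 'C(m, i) = \poly_(i < m.+1) 'C(m, i)%:R :> {poly K}.
  by rewrite poly_def; apply: eq_bigr => i _; rewrite scaler_nat.
by rewrite coef_poly ltnS; case: leqP => // /bin_small ->.
Qed.

Lemma foldr_shift_nseq0 (V : nmodType) (L : pzRingType) (c : L) (f : V -> L) m y :
  foldr (shift_step c) f (nseq m 0) y = (1 + c) ^+ m * f y.
Proof.
elim: m y => [|m IHm] y /=; first by rewrite mul1r.
by rewrite /shift_step !IHm addr0 exprS -mulrA mulrDl mul1r.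
Qed.

Lemma third_difference_free_comp (V : zmodType) (L L' : nmodType)
    (f : V -> L) (g : {additive L -> L'}) :
  third_difference_free f -> third_difference_free (g \o f).
Proof. by move=> f_quad x y z; rewrite /= -!raddfD f_quad. Qed.

(** A second difference is a sum of first differences,
    [2 - T_x - T_(-x) = (1 - T_x) + (1 - T_(-x))], so each product of [m] second
    differences is a combination of products of [m] first differences. *)
Lemma vanishing_half_diff2_of_shift (V : zmodType) (K : numFieldType) (f : V -> K) m :
  (forall s, size s = m -> foldr (shift_step (- 1)) f s 0 = 0) ->
  vanishing_half_diff2 f m.
Proof.
have step_half x (g : V -> K) y : half_diff2 x g y =
    1 / 2 * (shift_step (- 1) x g y + shift_step (- 1) (- x) g y).
  by rewrite /half_diff2 /sym_step /shift_step; field.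
have lin s (g g1 g2 : V -> K) y :
    (forall z, g z = 1 / 2 * (g1 z + g2 z)) ->
    foldr (shift_step (- 1)) g s y = 1 / 2 *
     (foldr (shift_step (- 1)) g1 s y + foldr (shift_step (- 1)) g2 s y).
  move=> gE; elim: s y => //= x s IHs y; rewrite /shift_step !IHs; ring.
move=> f_van s sz.
(* Directions move from the first differences [t] to the second ones [r]. *)
suff H t r : (size t + size r)%N = m ->
    foldr (shift_step (- 1)) (foldr (@half_diff2 V K) f r) t 0 = 0 by exact: (H [::]).
elim: r t => [|x r IHr] t; first by rewrite addn0; exact: f_van.
rewrite /= -addSnnS => szt.
rewrite (lin _ _ _ _ _ (step_half x _)) -!foldr_rcons !IHr ?size_rcons //.
by rewrite addr0 mulr0.
Qed.

Section Identities.
Variables (K : numFieldType) (V : normedModType K).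
Local Notation q := (@sqnorm K V).

Lemma identity_bE n (x : 'I_n -> V) :
  identity_b x <-> foldr (shift_step (- 1)) q [seq x i | i <- enum 'I_n] 0 = 0.
Proof. by rewrite -sum_sets_shift. Qed.

Lemma map_enum_nth n (s : seq V) : size s = n ->
  [seq nth 0 s (i : 'I_n) | i <- enum 'I_n] = s.
Proof.
move=> sz; rewrite (map_comp (nth 0 s) val) val_enum_ord -sz.
exact: mkseq_nth.
Qed.

Lemma identity_b_third_difference n : (3 <= n)%N ->
  third_difference_free q -> forall x : 'I_n -> V, identity_b x.
Proof.
move=> n_ge3 quad x; apply/identity_bE.
rewrite (@foldr_shift_quad _ _ _ quad _ _ (n - 2)%N).
  by rewrite subrr expr0n subn_eq0 leqNgt n_ge3 mul0r.
by rewrite size_map size_enum_ord; lia.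
Qed.

Lemma identity_b_parallelogram n : (3 <= n)%N ->
  (forall x : 'I_n -> V, identity_b x) -> parallelogram q.
Proof.
move=> n_ge3 id_b.
apply: (@vanishing_half_diff2_parallelogram _ _ _ n) => //.
- exact: sqnorm_double.
- exact: sqnormN.
- exact: sqnorm0.
- exact: ltnW.
apply: vanishing_half_diff2_of_shift => s sz.
by have /identity_bE := id_b (fun i => nth 0 s i); rewrite map_enum_nth.
Qed.

(** The identities for all [k] are collected in one polynomial: the coefficients
    of [(1 + 'X)^(n - 2) 'X^2] and [(1 + 'X)^(n - 2) 'X] are the binomials
    of the identity. *)
Lemma identity_aE n k (x : 'I_n -> V) (s := [seq x i | i <- enum 'I_n]) : (2 <= k)%N ->
  identity_a k x <->
  (foldr (shift_step 'X) (polyC \o q) s 0 - (1 + 'X) ^+ (n - 2) *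
    ('X^2 * (sqnorm (\sum_(v <- s) v))%:P + 'X * \sum_(v <- s) (sqnorm v)%:P))`_k = 0.
Proof.
move=> k_ge2; rewrite -sum_sets_shift.
rewrite !(big_map x) !big_enum /= -rmorph_sum /= mulrDr coefB coefD.
rewrite !mulrA !coefMC !coefMX !coef_exp1X.
have -> : (\sum_(A : {set 'I_n}) 'X^#|A| * (sqnorm (\sum_(i in A) x i))%:P)`_k =
   \sum_(A : {set 'I_n} | #|A| == k) `|\sum_(i in A) x i| ^+ 2.
  rewrite coef_sum [RHS]big_mkcond /=; apply: eq_bigr => A _.
  by rewrite coefMC coefXn eq_sym; case: eqP; rewrite ?mul1r ?mul0r.
case: k k_ge2 => [|[|k]] // _; rewrite /identity_a !subn2 subn1 /=.
rewrite /sqnorm.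
set S := \sum_(A | _) `|_| ^+ 2; split=> [->|/eqP]; first by ring.
by rewrite opprD addrA addrAC subr_eq0 => /eqP ->.
Qed.

Lemma identity_a_third_difference n k : (2 <= k < n)%N ->
  third_difference_free q -> forall x : 'I_n -> V, identity_a k x.
Proof.
case/andP=> k_ge2 k_lt quad x; apply/identity_aE => //.
set s := [seq x i | i <- enum 'I_n].
have quadP : third_difference_free (polyC \o q).
  exact: third_difference_free_comp.
rewrite (@foldr_shift_quad _ _ _ quadP _ _ (n - 2)%N); last first.
  by rewrite size_map size_enum_ord; lia.
rewrite add0r /= sqnorm0 polyC0 mulr0 add0r.
rewrite (_ : _ - _ = 0) ?coef0 //; ring.
Qed.

(** For the vectors [u, v, - v, 0, ..., 0] the generating polynomial is
    [(1 + 'X)^(n - 3) 'X^2] times the defect of the parallelogram law at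
    [u, v], and ['C(n - 3, k - 2)] is positive. *)
Lemma identity_a_parallelogram n k : (2 <= k < n)%N ->
  (forall x : 'I_n -> V, identity_a k x) -> parallelogram q.
Proof.
case/andP=> k_ge2 k_lt id_a u v.
pose m := (n - 3)%N; pose s := [:: u; v; - v] ++ nseq m 0.
have szs : size s = n by rewrite /= size_nseq /m; lia.
have /(identity_aE _ k_ge2) := id_a (fun i => nth 0 s i).
rewrite map_enum_nth // !big_cat /= !big_nseq !big_cons !big_nil /=.
rewrite /shift_step !foldr_shift_nseq0 /= sqnormN sqnorm0.
rewrite !add0r !subrr !addr0 (_ : n - 2 = m.+1)%N; last by rewrite /m; lia.
have iter0 (W : nmodType) j : iter j (+%R (0 : W)) 0 = 0.
  by elim: j => //= j ->; rewrite addr0.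
rewrite !iter0 !addr0 addrK sqnorm0 addrN addr0 sqnormN.
rewrite (_ : _ - _ = (1 + 'X) ^+ m * 'X^2 *
    (sqnorm (u + v) + sqnorm (u - v) - (sqnorm u *+ 2 + sqnorm v *+ 2))%:P);
  last by rewrite exprS rmorphB !mulr2n !rmorphD /= polyC0; ring.
rewrite coefMC coefMXn ltnNge k_ge2 coef_exp1X => /eqP.
rewrite mulf_eq0 pnatr_eq0 -leqn0 leqNgt bin_gt0 /m.
by rewrite (_ : k - 2 <= n - 3)%N ?subr_eq0 => [/eqP|]; last by lia.
Qed.

End Identities.

(** * The Jordan-von Neumann theorem *)

Section Additive.
Variables (R : archiRealFieldType) (phi : R -> R) (C : R).
Hypothesis phiD : {morph phi : s t / s + t}.
Hypothesis phi_le : forall t, 0 <= t <= 1 -> `|phi t| <= C.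

(** The defect [psi t = phi t - t phi 1] is additive and vanishes on integers, so
    it is bounded on the whole line by its bound on [[0, 1]].  Then
    [n |psi t| = |psi (n t)|] is bounded in [n], which forces [psi t = 0]. *)
Lemma additive_bounded_linear t : phi t = t * phi 1.
Proof.
pose psi s := phi s - s * phi 1.
have psiD : {morph psi : s t / s + t} by move=> r s; rewrite /psi phiD; ring.
have psi0 : psi 0 = 0 by apply: (addrI (psi 0)); rewrite -psiD !addr0.
have psiN s : psi (- s) = - psi s.
  by apply: (addrI (psi s)); rewrite -psiD !subrr.
have psi1 : psi 1 = 0 by rewrite /psi mul1r subrr.
have psi_nat n s : psi (s *+ n) = psi s *+ n.
  by elim: n => [|n IHn]; rewrite ?psi0 // !mulrS psiD IHn.
have psi_int (m : int) : psi m%:~R = 0.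
  by case: m => n; rewrite ?NegzE ?mulrNz ?psiN -pmulrn psi_nat psi1 mul0rn ?oppr0.
have psi_le s : `|psi s| <= C + `|phi 1|.
  rewrite -[s](subrK (Num.floor s)%:~R) psiD psi_int addr0.
  set r := s - _; have /andP[r0 r1] : 0 <= r <= 1.
    by rewrite subr_ge0 floor_le lerBlDl ltW // -[X in _ + X]/(1%:~R) -intrD floorD1_gt.
  rewrite (le_trans (ler_normB _ _)) // lerD ?phi_le ?r0 // normrM ger0_norm //.
  exact: ler_piMl.
apply/eqP; rewrite -subr_eq0 -/(psi t) -normr_le0 leNgt; apply/negP => psi_gt0.
have C0 : 0 <= C + `|phi 1| by exact: le_trans (psi_le 0).
have := archi_boundP (divr_ge0 C0 (ltW psi_gt0)); set n := Num.Def.archi_bound _.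
by rewrite ltr_pdivrMr // ltNge -normr_nat -normrM mulr_natl -psi_nat psi_le.
Qed.

End Additive.

Section Polarization.
Variables (V : zmodType) (R : realFieldType) (f : V -> R).
Hypothesis f_par : parallelogram f.

Lemma parallelogram0 : f 0 = 0.
Proof. have := f_par 0 0; rewrite subrr addr0 -!mulr2n => e; lra. Qed.

Lemma parallelogramN v : f (- v) = f v.
Proof. have := f_par 0 v; rewrite !add0r parallelogram0 => e; lra. Qed.

(** The core of the Jordan-von Neumann theorem: the sum of the laws
    for [(x + z, y)] and [(x + y, z)], minus the one for [(x, z - y)] and twice
    the one for [(y, z)]. *)
Lemma parallelogram_third_difference : third_difference_free f.
Proof.
move=> x y z; have e1 := f_par (x + z) y; have e2 := f_par x (z - y).
have e3 := f_par (x + y) z; have e4 := f_par y z.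
move: e1 e2 e3 e4; rewrite opprB -(parallelogramN (z - y)) opprB.
rewrite [x + z + y]addrAC -!addrA => *; lra.
Qed.

Definition polar x y := f (x + y) - f x - f y.

Lemma polarC x y : polar x y = polar y x.
Proof. by rewrite /polar [y + x]addrC; ring. Qed.

Lemma polarDl x x' y : polar (x + x') y = polar x y + polar x' y.
Proof. have := parallelogram_third_difference x x' y; rewrite /polar => e; lra. Qed.

Lemma polarNl x y : polar (- x) y = - polar x y.
Proof.
have := polarDl x (- x) y; rewrite subrr /polar parallelogram0 add0r => e; lra.
Qed.

Lemma polarxx x : polar x x = f x *+ 2.
Proof. have := f_par x x; rewrite /polar subrr parallelogram0 => e; lra. Qed.

End Polarization.

(** Real and complex spaces are treated together: [iota] embeds the real scalars
    and [N] is the norm with its values read in the real field. *)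
Section RealStructure.
Variables (R : archiRealFieldType) (K : numFieldType) (iota : {rmorphism R -> K}).
Hypothesis iota_ge0 : forall t, 0 <= t -> 0 <= iota t.
Variables (V : normedModType K) (N : V -> R).
Hypothesis N_norm : forall v, `|v| = iota (N v).

Let iota_inj : injective iota := fmorph_inj iota.

Let iota_le s t : (iota s <= iota t) = (s <= t).
Proof.
apply/idP/idP => [|st]; last by rewrite -subr_ge0 -rmorphB iota_ge0 ?subr_ge0.
apply: contraTT; rewrite -ltNge => ts; rewrite lt_geF // lt_neqAle.
rewrite (inj_eq iota_inj) (lt_eqF ts) /= -subr_ge0 -rmorphB iota_ge0 //.
by rewrite subr_ge0 ltW.
Qed.

Let N_ge0 v : 0 <= N v.
Proof. by rewrite -iota_le rmorph0 -N_norm. Qed.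

Let ND u v : N (u + v) <= N u + N v.
Proof. by rewrite -iota_le rmorphD -!N_norm ler_normD. Qed.

Let NN v : N (- v) = N v.
Proof. by apply: iota_inj; rewrite -!N_norm normrN. Qed.

Let NZ t v : 0 <= t -> N (iota t *: v) = t * N v.
Proof.
move=> t0; apply: iota_inj.
by rewrite rmorphM -!N_norm normrZ ger0_norm ?iota_ge0.
Qed.

Hypothesis par : parallelogram (@sqnorm K V).

Definition real_sqnorm v := N v ^+ 2.

Lemma real_sqnorm_parallelogram : parallelogram real_sqnorm.
Proof.
move=> x y; apply: iota_inj; rewrite !(rmorphD, rmorphMn) /= !rmorphXn -!N_norm.
exact: par.
Qed.

Let polar_le u v : `|polar real_sqnorm u v| <= 2 * N u * N v.
Proof.
have H w : polar real_sqnorm w v <= 2 * N w * N v.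
  have := lerXn2r 2 (N_ge0 _) (addr_ge0 (N_ge0 _) (N_ge0 _)) (ND w v).
  rewrite /polar /real_sqnorm sqrrD => e; lra.
rewrite ler_norml H andbT lerNl -(polarNl real_sqnorm_parallelogram) -(NN u).
exact: H.
Qed.

(** Additivity makes the polar form rational-linear; the bound [2 N u N v], a
    consequence of the triangle inequality, replaces continuity in passing to
    real scalars. *)
Lemma polar_scale_real t u v :
  polar real_sqnorm (iota t *: u) v = t * polar real_sqnorm u v.
Proof.
pose phi s := polar real_sqnorm (iota s *: u) v.
suff: phi t = t * phi 1 by rewrite /phi rmorph1 scale1r.
apply: (additive_bounded_linear (C := 2 * N u * N v)) => [r s|s /andP[s0 s1]].
  by rewrite /phi rmorphD scalerDl polarDl //; exact: real_sqnorm_parallelogram.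
apply: le_trans (polar_le _ _) _; rewrite NZ // -!mulrA ler_pM2l //.
by rewrite ler_piMl // mulr_ge0.
Qed.

End RealStructure.

Lemma hermitian_dot (K : numFieldType) (theta : {rmorphism K -> K})
    (V : lmodType K) (ip : V -> V -> K) :
  (forall z, {morph ip ^~ z : x y / x + y}) ->
  (forall a x z, ip (a *: x) z = a * ip x z) ->
  (forall x y, ip x y = theta (ip y x)) ->
  (forall x, x != 0 -> 0 < ip x x) ->
  exists d : {dot V for theta}, forall x, d x x = ip x x.
Proof.
move=> ipD ipZ ipC ip_gt0.
have ip_linear z : linear_for *%R (ip ^~ z) by move=> a x y; rewrite ipD ipZ.
have ip_semilinear x : linear_for (theta \; *%R) (ip x).
  by move=> a y z; rewrite ipC ipD ipZ rmorphD rmorphM -!ipC.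
have ip_bilin : sesquilinear.bilinear_for *%R (theta \; *%R) ip by [].
have herm x y : ip x y = (-1) ^+ false * theta (ip y x) by rewrite mul1r -ipC.
pose bilin_mixin := sesquilinear.bilinear_isBilinear.Build K V V K
   *%R (theta \; *%R) ip ip_bilin.
pose herm_mixin := sesquilinear.isHermitianSesquilinear.Build K V false theta ip herm.
pose dot_mixin := sesquilinear.isDotProduct.Build K V ip ip_gt0.
pose d : {dot V for theta} := HB.pack ip bilin_mixin herm_mixin dot_mixin.
by exists d.
Qed.

Lemma real_parallelogram_inner_product (R : archiRealFieldType) (V : normedModType R) :
  parallelogram (@sqnorm R V) -> norm_given_by_inner_product idfun V.
Proof.
move=> par; pose f := real_sqnorm (@Num.norm R V).
have f_par : parallelogram f by [].
have [||||d dE] := @hermitian_dot R idfun V (fun x y => 1 / 2 * polar f x y).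
- by move=> z x y; rewrite polarDl // mulrDr.
- move=> a x z.
  rewrite (@polar_scale_real R R idfun _ V _ _ par) //.
  by rewrite mulrCA.
- by move=> x y; rewrite polarC.
- move=> x x0; rewrite polarxx // mulr_gt0 ?divr_gt0 //.
  by rewrite mulrn_wgt0 // exprn_gt0 // normr_gt0.
exists d => x; rewrite dE polarxx // /f /real_sqnorm.
by field.
Qed.

Section Complex.
Variables (R : realType) (V : normedModType R[i]).
Hypothesis par : parallelogram (@sqnorm R[i] V).

Let N (v : V) : R := complex.Re `|v|.
Let N_norm v : `|v| = real_complex R (N v).
Proof. by rewrite /N RRe_real // normr_real. Qed.

Let f := real_sqnorm N.
Let f_par : parallelogram f.
Proof. exact: (@real_sqnorm_parallelogram R R[i] (real_complex R) V N N_norm par). Qed.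

Let b := polar f.

Let bZ t u v : b ((t%:C)%C *: u) v = t * b u v.
Proof.
apply: (@polar_scale_real R R[i] (real_complex R) _ V N N_norm par).
by move=> s; rewrite ler0c.
Qed.

Let b_i u v : b ('i%C *: u) ('i%C *: v) = b u v.
Proof.
have fi w : f ('i%C *: w) = f w.
  rewrite /f /real_sqnorm /N normrZ normc_def /= expr0n /= expr1n add0r sqrtr1.
  by rewrite mul1r.
by rewrite /b /polar -scalerDr !fi.
Qed.

Let b_il u v : b ('i%C *: u) v = - b u ('i%C *: v).
Proof.
rewrite -[in RHS]b_i scalerA -expr2 sqr_i scaleN1r /b [polar f _ (- v)]polarC polarNl // opprK.
exact: polarC.
Qed.

(** The real part of the inner product is half the polar form [b]; since [b] is
    invariant under multiplication by ['i], [b (x, 'i y) = - b ('i x, y)], and half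
    of it is the imaginary part that gives linearity in [x]. *)
Lemma complex_parallelogram_inner_product : norm_given_by_inner_product Num.conj V.
Proof.
pose ip x y := ((1 / 2 * b x y) +i* (1 / 2 * b x ('i%C *: y)))%C.
have ipxx x : ip x x = (f x)%:C%C.
  have bxx : b x ('i%C *: x) = 0.
    have := b_il x x; rewrite /b polarC => e; lra.
  by rewrite /ip bxx mulr0 /b polarxx //; congr (_ +i* _)%C; field.
have [||||d dE] := @hermitian_dot R[i] Num.conj V ip.
- by move=> z x y; rewrite /ip /b !polarDl // !mulrDr.
- move=> [s t] x z; rewrite /ip.
  have -> : ((s +i* t)%C *: x) = (s%:C)%C *: x + (t%:C)%C *: ('i%C *: x).
    by rewrite scalerA -scalerDl; congr (_ *: _); simpc.
  rewrite /b !polarDl // -!/(b _ _) !bZ b_i b_il.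
  by simpc; congr (_ +i* _)%C; ring.
- move=> x y; rewrite [RHS](_ : _ = ((ip y x)^*)%C) // /ip /=.
  rewrite -[in RHS](opprK (b y ('i%C *: x))) -b_il /b [polar f y x]polarC.
  by rewrite [polar f _ x]polarC; congr (_ +i* _)%C; ring.
- move=> x x0; rewrite ipxx ltcR /f /real_sqnorm exprn_gt0 //.
  by rewrite -ltcR -N_norm normr_gt0.
exists d => x; rewrite dE ipxx /f /real_sqnorm N_norm.
by rewrite rmorphXn.
Qed.

End Complex.

(** * The characterizations *)

Lemma inner_product_third_difference (K : numFieldType) (theta : K -> K)
    (V : normedModType K) :
  norm_given_by_inner_product theta V -> third_difference_free (@sqnorm K V).
Proof.
case=> ip ipE x y z; rewrite /sqnorm !ipE !sesquilinear.linearDl !linearD /=.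
ring.
Qed.

Section Equivalences.
Variables (K : numFieldType) (theta : K -> K) (V : normedModType K).
Hypothesis jordan_von_neumann :
  parallelogram (@sqnorm K V) -> norm_given_by_inner_product theta V.

Lemma inner_product_parallelogram :
  norm_given_by_inner_product theta V <-> parallelogram (@sqnorm K V).
Proof.
split=> [/inner_product_third_difference|]; last exact: jordan_von_neumann.
exact: third_difference_free_parallelogram (@sqnormN K V).
Qed.

Lemma inner_product_identity_a n k : (2 <= k < n)%N ->
  norm_given_by_inner_product theta V <-> (forall x : 'I_n -> V, identity_a k x).
Proof.
move=> kn; split=> [/inner_product_third_difference quad|id_a].
  exact: identity_a_third_difference.
exact/jordan_von_neumann/(identity_a_parallelogram kn).
Qed.

Lemma inner_product_identity_b n : (3 <= n)%N ->
  norm_given_by_inner_product theta V <-> (forall x : 'I_n -> V, identity_b x).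
Proof.
move=> n_ge3; split=> [/inner_product_third_difference quad|id_b].
  exact: identity_b_third_difference.
exact/jordan_von_neumann/(identity_b_parallelogram n_ge3).
Qed.

Lemma inner_product_identity_c n (a : 'I_n -> K) :
  (exists i j : 'I_n, [/\ i != j, a i = - (1 / 2) & a j = - (1 / 2)]) ->
  norm_given_by_inner_product theta V <-> (forall x : 'I_n -> V, identity_c a x).
Proof.
by move=> a_half; rewrite inner_product_parallelogram identity_c_parallelogram.
Qed.

End Equivalences.

Theorem corollary4p5 (R : realType) :
  (forall H : normedModType R,
    [/\ forall n k : nat, (2 <= k < n)%N ->
          norm_given_by_inner_product idfun H <->
          (forall x : 'I_n -> H, identity_a k x),
        forall n : nat, (3 <= n)%N ->
          norm_given_by_inner_product idfun H <->
          (forall x : 'I_n -> H, identity_b x)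
      & forall (n : nat) (a : 'I_n -> R), (2 <= n)%N ->
          (exists i j : 'I_n, [/\ i != j, a i = - (1 / 2) & a j = - (1 / 2)]) ->
          norm_given_by_inner_product idfun H <->
          (forall x : 'I_n -> H, identity_c a x)])
  /\
  (forall H : normedModType R[i],
    [/\ forall n k : nat, (2 <= k < n)%N ->
          norm_given_by_inner_product Num.conj H <->
          (forall x : 'I_n -> H, identity_a k x),
        forall n : nat, (3 <= n)%N ->
          norm_given_by_inner_product Num.conj H <->
          (forall x : 'I_n -> H, identity_b x)
      & forall (n : nat) (a : 'I_n -> R), (2 <= n)%N ->
          (exists i j : 'I_n, [/\ i != j, a i = - (1 / 2) & a j = - (1 / 2)]) ->
          norm_given_by_inner_product Num.conj H <->
          (forall x : 'I_n -> H, identity_c (fun i => ((a i)%:C)%C) x)]).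
Proof.
split=> H.
  have jvn := @real_parallelogram_inner_product R H.
  split=> [n k|n|n a _]; first exact: inner_product_identity_a.
    exact: inner_product_identity_b.
  exact: inner_product_identity_c.
have jvn := @complex_parallelogram_inner_product R H.
split=> [n k|n|n a _ [i [j [ij ai aj]]]]; first exact: inner_product_identity_a.
  exact: inner_product_identity_b.
apply: inner_product_identity_c => //; exists i, j; split=> //.
  by rewrite ai rmorphN fmorph_div rmorph1 rmorph_nat.
by rewrite aj rmorphN fmorph_div rmorph1 rmorph_nat.
Qed.
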